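(* Let $S$ be a sample space consisting of $12$ equally likely outcomes, each of probability $1/12$. Let $K_2$ be the total number, over all $k\ge 2$, of unordered tuples $\{A_1,\dots,A_k\}$ of $k$ distinct (mutually) independent events $A_i\subset S$ with $0<|A_i|<12$ for all $i$. Then $$K_2=K_1+2n_5=30{,}826{,}488,$$ where $K_1=888{,}888$ is the number of such tuples with $k=2$, and $2n_5$ with $n_5=14{,}968{,}800$ is the number of such tuples with $k=3$; there are no such tuples with $k\ge 4$.
   Context: Events are subsets of $S$, with $P(A)=|A|/12$ (this is the sample space of flipping a fair coin and then tossing a fair die). Events $A_1,\dots,A_k$ are (mutually) independent if $P\left(\bigcap_{i\in I}A_i\right)=\prod_{i\in I}P(A_i)$ for every nonempty $I\subset\{1,\dots,k\}$. Tuples are counted without regard to order, and the trivial events $\emptyset$ and $S$ are excluded. *)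

(* Defs.v *)
From mathcomp Require Import all_boot all_order all_algebra.

Set Implicit Arguments.
Unset Strict Implicit.
Unset Printing Implicit Defensive.

Import GRing.Theory Num.Theory.

Section Independence.
Variable S : finType.

Definition prob (A : {set S}) : rat := (#|A|%:R / #|S|%:R)%R.

Definition independent (k : nat) (A : 'I_k -> {set S}) : bool :=
  [forall I : {set 'I_k}, (I != set0) ==>
    (prob (\bigcap_(i in I) A i) == \prod_(i in I) prob (A i))%R].

(* The unordered tuples {A_1, ..., A_k} are encoded as sets of events: the
   images of the injective families A : 'I_k -> {set S}; every such set has
   exactly k elements. *)
Definition indep_tuples (k : nat) : {set {set {set S}}} :=
  [set [set A i | i : 'I_k] | A : {ffun 'I_k -> {set S}} &
    [&& injectiveb A, [forall i, 0 < #|A i| < #|S|] & independent A]].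

(* All k >= 2 together; k is recovered as the cardinal of the set of events. *)
Definition all_indep_tuples : {set {set {set S}}} :=
  [set F : {set {set S}} | (2 <= #|F|) && (F \in indep_tuples #|F|)].

End Independence.

(* Main.v *)
From Stdlib Require Import DecimalNat DecimalPos Lia.
Require Import Defs.
From mathcomp Require Import all_boot all_order all_algebra.
From mathcomp Require Import zify.
Import BinNat.

(* Independence of distinct events only depends on the set they form, so each set of [k]
   events is the image of exactly [k!] ordered families, and ordered families can be
   counted instead. Independence of two or three events is a condition on the sizes of
   the atoms they generate; adding the events one at a time, the number of choices for
   given atom sizes is a product of binomial coefficients, and a finite sum over the
   sizes remains. In an independent triple of proper events exactly two of the sizes are
   6 (the third is 4 or 8), which cannot hold for all triples out of four events. *)

(** * Sums over subsets, by traces on atoms *)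

(** A subset of [E] amounts to two free choices, its parts inside and outside [D]; their union gives
    it back. *)
Lemma sum_subset_split {S : finType} (D E : {set S}) (G : {set S} -> {set S} -> nat) :
  \sum_(C : {set S} | C \subset E) G (C :&: D) (C :\: D) =
  \sum_(X : {set S} | X \subset E :&: D) \sum_(Y : {set S} | Y \subset E :\: D) G X Y.
Proof.
rewrite pair_big /=.
rewrite (reindex_onto (fun p : {set S} * {set S} => p.1 :|: p.2)
          (fun C => (C :&: D, C :\: D))) /=; last by move=> C _; rewrite setID.
apply: eq_big => [[X Y]|[X Y] /= /andP[_ /eqP[-> ->]]//] /=.
rewrite subUset xpair_eqE setIUl setDUl.
apply/idP/idP.
  move=> /andP[/andP[XE YE] /andP[/eqP XD /eqP YD]].
  rewrite subsetI XE -{1}XD -setIUl subsetIr /= subsetD YE -YD -setDUl.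
  by rewrite disjoints_subset subsetDr.
rewrite subsetI subsetD => /andP[/andP[XE XD] /andP[YE YD]].
rewrite XE YE (setIidPl XD) (setDidPl YD).
have -> : Y :&: D = set0 by apply/eqP; rewrite setI_eq0.
have -> : X :\: D = set0 by apply/eqP; rewrite setD_eq0.
by rewrite setU0 set0U !eqxx.
Qed.

Definition bsum (n : nat) (F : nat -> nat) : nat := \sum_(x < n.+1) 'C(n, x) * F x.

Lemma sum_subset_card {S : finType} (E : {set S}) (F : nat -> nat) :
  \sum_(X : {set S} | X \subset E) F #|X| = bsum #|E| F.
Proof.
(* [inord] only truncates sizes above [#|E|], which no subset of [E] has. *)
rewrite (partition_big (fun X : {set S} => inord #|X| : 'I_#|E|.+1) predT) //=.
apply: eq_bigr => x _.
rewrite -cards_draws -[X in _ = X * _]sum1_card big_distrl /= big_set /=.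
have szE (X : {set S}) : X \subset E -> (inord #|X| == x) = (#|X| == x :> nat).
  by move=> XE; rewrite -val_eqE /= inordK // ltnS subset_leq_card.
apply: eq_big => X; first by rewrite unfold_in /=; apply: andb_id2l => /szE.
by move=> /andP[XE]; rewrite szE // => /eqP ->; rewrite mul1n.
Qed.

Lemma sum_subset_split_card {S : finType} (D E : {set S}) (F : nat -> nat -> nat) :
  \sum_(C : {set S} | C \subset E) F #|C :&: D| #|C :\: D| =
  bsum #|E :&: D| (fun x => bsum #|E :\: D| (F x)).
Proof.
rewrite (sum_subset_split _ _ (fun X Y => F #|X| #|Y|)) -sum_subset_card.
by apply: eq_bigr => X _; rewrite sum_subset_card.
Qed.

(* The four arguments of [F] are the sizes of the intersections of [C] with the atoms of
   the algebra generated by [A] and [B]. *)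
Lemma sum_set_split4 {S : finType} (A B : {set S}) (F : nat -> nat -> nat -> nat -> nat) :
  \sum_(C : {set S}) F #|C :&: A :&: B| #|C :&: A :\: B| #|(C :\: A) :&: B| #|C :\: A :\: B| =
  bsum #|A :&: B| (fun x11 => bsum #|A :\: B| (fun x10 =>
    bsum #|~: A :&: B| (fun x01 => bsum #|~: A :\: B| (F x11 x10 x01)))).
Proof.
rewrite (eq_bigl (fun C : {set S} => C \subset [set: S])); last by move=> C; rewrite subsetT.
(* [C] is cut by [A] first; then each of its two parts is cut by [B]. *)
rewrite (sum_subset_split _ _
  (fun X Y => F #|X :&: B| #|X :\: B| #|Y :&: B| #|Y :\: B|)) setTI setTD.
rewrite -(sum_subset_split_card _ _ (fun x11 x10 =>
  bsum #|~: A :&: B| (fun x01 => bsum #|~: A :\: B| (F x11 x10 x01)))).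
by apply: eq_bigr => X _; rewrite (sum_subset_split_card _ _ (F _ _)).
Qed.

(** * Sums over families, one entry at a time *)

Definition fcons {T : finType} {k : nat} (a : T) (f : {ffun 'I_k -> T}) : {ffun 'I_k.+1 -> T} :=
  [ffun i => if unlift ord0 i is Some j then f j else a].

Lemma fcons0 {T : finType} {k : nat} (a : T) (f : {ffun 'I_k -> T}) : fcons a f ord0 = a.
Proof. by rewrite ffunE unlift_none. Qed.

Lemma fconsS {T : finType} {k : nat} (a : T) (f : {ffun 'I_k -> T}) (i : 'I_k) :
  fcons a f (lift ord0 i) = f i.
Proof. by rewrite ffunE liftK. Qed.

Lemma sum_ffunS {T : finType} {k : nat} (G : {ffun 'I_k.+1 -> T} -> nat) :
  \sum_f G f = \sum_a \sum_f G (fcons a f).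
Proof.
rewrite pair_big /= (reindex (fun p : T * {ffun 'I_k -> T} => fcons p.1 p.2)) //=.
exists (fun f => (f ord0, [ffun i => f (lift ord0 i)])) => [[a f] _ | f _] /=.
  by congr pair; [exact: fcons0 | apply/ffunP => i; rewrite ffunE fconsS].
by apply/ffunP => i; rewrite ffunE; case: unliftP => [j|] ->; rewrite ?ffunE.
Qed.

Lemma sum_ffun0 {T : finType} (G : {ffun 'I_0 -> T} -> nat) (f0 : {ffun 'I_0 -> T}) :
  \sum_f G f = G f0.
Proof.
rewrite (big_pred1 f0) // => f; apply/esym/eqP/ffunP; case; case=> //.
Qed.

(** * Independence as a property of a set of events *)

Section Independence.
Context {S : finType}.
Hypothesis S_gt0 : 0 < #|S|.
Implicit Types F G : {set {set S}}.

Definition indep_events F : bool :=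
  [forall G : {set {set S}}, (G \subset F) ==>
    (#|\bigcap_(X in G) X| * #|S| ^ #|G| == #|S| * \prod_(X in G) #|X|)].

(** Clear denominators by multiplying by [#|S| ^ #|I|.+1]. The case of empty [I] can be included, as
    both sides are then [#|S|]. *)
Lemma independentE {k : nat} {A : 'I_k -> {set S}} :
  independent A = [forall I : {set 'I_k},
    #|\bigcap_(i in I) A i| * #|S| ^ #|I| == #|S| * \prod_(i in I) #|A i|].
Proof.
apply: eq_forallb => I; have [-> | _] := eqVneq; first by rewrite !big_set0 cards0 cardsT eqxx.
rewrite /= /prob GRing.prodf_div GRing.prodr_const -GRing.natrX -GRing.natr_prod.
rewrite GRing.eqr_div ?Num.Theory.pnatr_eq0 -?lt0n ?expn_gt0 ?S_gt0 //.
by rewrite -!GRing.natrM Num.Theory.eqr_nat (mulnC (\prod_(_ in _) _)).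
Qed.

(** Every subset of the image is the image of its preimage, and injectivity preserves cardinals and
    products. *)
Lemma independent_imset {k : nat} {A : 'I_k -> {set S}} : injective A ->
  independent A = indep_events [set A i | i : 'I_k].
Proof.
move=> A_inj; rewrite independentE.
have imE (I : {set 'I_k}) : (#|\bigcap_(X in A @: I) X| * #|S| ^ #|A @: I| == #|S| * \prod_(X in A @: I) #|X|)
  = (#|\bigcap_(i in I) A i| * #|S| ^ #|I| == #|S| * \prod_(i in I) #|A i|).
  by rewrite !big_imset ?card_imset //; apply: in2W.
apply/forallP/forallP => [indA G | indA I].
  apply/implyP => /subsetP GA; suff -> : G = A @: (A @^-1: G) by rewrite imE.
  apply/setP => X; apply/idP/imsetP => [XG | [i + ->]]; last by rewrite inE.
  by have /imsetP[i _ XA] := GA _ XG; exists i; rewrite // inE -XA.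
by rewrite -imE; apply: (implyP (indA _)); apply/subsetP => X /imsetP[i _ ->]; rewrite imset_f.
Qed.

Lemma mem_indep_tuples (k : nat) F :
  (F \in indep_tuples S k) =
  [&& #|F| == k, [forall X in F, 0 < #|X| < #|S|] & indep_events F].
Proof.
apply/imsetP/idP => [[A] | /and3P[/eqP Fk /forall_inP szF indF]].
  rewrite inE => /and3P[/injectiveP A_inj /forallP szA indA] ->.
  rewrite card_imset // card_ord eqxx -independent_imset // indA andbT.
  by apply/forall_inP => _ /imsetP[i _ ->].
(* Any enumeration of [F] serves as the family. *)
pose A : {ffun 'I_k -> {set S}} := [ffun i => enum_val (cast_ord (esym Fk) i)].
have A_inj : injective A.
  by move=> i j; rewrite !ffunE => /enum_val_inj /cast_ord_inj.
have FA : F = [set A i | i : 'I_k].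
  apply/esym/eqP; rewrite eqEcard card_imset // card_ord Fk leqnn andbT.
  by apply/subsetP => _ /imsetP[i _ ->]; rewrite ffunE enum_valP.
exists A => //; rewrite inE independent_imset // -FA indF andbT.
rewrite (introT (injectiveP _) A_inj) /=.
by apply/forallP => i; apply: szF; rewrite ffunE enum_valP.
Qed.

(** The fibre of the image map over [F] consists of all injections of ['I_k] into [F], since the
    other conditions depend on [F] only. *)
Lemma card_indep_families (k : nat) :
  #|[set A : {ffun 'I_k -> {set S}} |
     [&& injectiveb A, [forall i, 0 < #|A i| < #|S|] & independent A]]| =
  k`! * #|indep_tuples S k|.
Proof.
set good := [set A | _].
rewrite -sum1_card (partition_big_imset (fun A : {ffun 'I_k -> {set S}} => [set A i | i : 'I_k])) /=.
rewrite -/(indep_tuples S k) mulnC -sum_nat_const; apply: eq_bigr => F indF.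
have /and3P[/eqP Fk /forall_inP szF evF] := etrans (esym (mem_indep_tuples k F)) indF.
have <- : #|[set A : {ffun 'I_k -> {set S}} in ffun_on (mem F) | injectiveb A]| = k`!.
  by rewrite card_inj_ffuns_on card_ord Fk ffactnn.
rewrite -sum1_card; apply: eq_bigl => A.
rewrite !inE; apply/idP/idP.
  move=> /andP[/and3P[A_inj _ _] /eqP AF]; rewrite A_inj andbT.
  by apply/ffun_onP => i; rewrite -AF imset_f.
move=> /andP[/ffun_onP AF injA]; have A_inj := injectiveP _ injA.
have FA : [set A i | i : 'I_k] = F.
  apply/eqP; rewrite eqEcard card_imset // card_ord Fk leqnn andbT.
  by apply/subsetP => _ /imsetP[i _ ->].
rewrite injA independent_imset // FA evF eqxx !andbT /=.
by apply/forallP => i; apply: szF.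
Qed.

Lemma independent_seq {k : nat} {A : 'I_k -> {set S}} (s : seq 'I_k) :
  independent A -> uniq s ->
  #|\bigcap_(i <- s) A i| * #|S| ^ size s = #|S| * \prod_(i <- s) #|A i|.
Proof.
rewrite independentE => /forallP /(_ [set i in s]) /eqP + s_uniq.
by rewrite !big_set cardsE (card_uniqP s_uniq) -!big_uniq.
Qed.

(** An event independent of a copy of itself satisfies [#|A i| * #|S| = #|A i| ^ 2], so it is empty
    or full. Injectivity can thus be dropped when counting families. *)
Lemma independent_injective {k : nat} {A : 'I_k -> {set S}} :
  (forall i, 0 < #|A i| < #|S|) -> independent A -> injective A.
Proof.
move=> szA indA i j Aij; apply/eqP; apply: contraT => ij.
have := independent_seq [:: i; j] indA; rewrite /= inE ij => /(_ isT).
rewrite !big_cons !big_nil -Aij setIT setIid muln1 expnS expn1 => /eqP.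
have /andP[A0 AS] := szA i.
rewrite mulnCA eqn_pmul2l // eqn_pmul2l // => /eqP SA.
by rewrite SA ltnn in AS.
Qed.

End Independence.

Lemma forallb_big {I : finType} (P : pred I) : [forall i, P i] = \big[andb/true]_i P i.
Proof. by rewrite big_andE. Qed.

(** * Twelve outcomes: independence in terms of sizes *)

Section Twelve.
Variable S : finType.
Hypothesis hS : #|S| = 12.

Let S_gt0 : 0 < #|S|. Proof. by rewrite hS. Qed.

Definition proper_size (a : nat) : bool := 0 < a < 12.

Definition indep_sizes2 (a b ab : nat) : bool :=
  [&& proper_size a, proper_size b & 12 * ab == a * b].

Definition indep_sizes3 (a b c ab ac bc abc : nat) : bool :=
  [&& indep_sizes2 a b ab, proper_size c, 12 * ac == a * c, 12 * bc == b * c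
    & 144 * abc == a * b * c].

Lemma card_indep_familiesE (k : nat) :
  k`! * #|indep_tuples S k| =
  \sum_(A : {ffun 'I_k -> {set S}}) ([forall i, proper_size #|A i|] && independent A).
Proof.
rewrite -card_indep_families // -sum1_card big_mkcond /=.
apply: eq_bigr => A _; rewrite inE hS /proper_size.
case szA: [forall i, _]; last by rewrite andbF.
case indA: (independent A); last by rewrite !andbF.
rewrite (introT (injectiveP _)) //.
by apply: independent_injective => // i; rewrite hS; apply: (forallP szA).
Qed.

Lemma card_indep_pairs :
  2 * #|indep_tuples S 2| =
  \sum_(A : {set S}) \sum_(B : {set S}) indep_sizes2 #|A| #|B| #|A :&: B|.
Proof.
rewrite -[2]/(2`!) card_indep_familiesE sum_ffunS; apply: eq_bigr => A _.
rewrite sum_ffunS; apply: eq_bigr => B _.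
(* There is a single empty family, so its default value is immaterial. *)
rewrite (sum_ffun0 _ [ffun=> set0]); congr nat_of_bool.
rewrite forallb_big !big_ord_recl big_ord0 /= !fconsS !fcons0 andbT -andbA.
congr [&& _, _ & _]; apply/idP/idP => [indA | /eqP AB].
  have /= := independent_seq S_gt0 [:: ord0; lift ord0 ord0] indA isT.
  by rewrite !big_cons !big_nil !fconsS !fcons0 setIT hS; lia.
rewrite independentE //; apply/forallP => I.
(* With membership in [I] as a test in each term, a case split on the tests covers all index
   sets. *)
rewrite -[#|I|]sum1_card !(big_mkcond (fun i => i \in I)).
rewrite !big_ord_recl !big_ord0 /= !fconsS !fcons0 hS.
by case: (_ \in I); case: (_ \in I); rewrite /= ?setIT ?setTI ?cardsT ?hS; lia.
Qed.

Lemma card_indep_triples :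
  6 * #|indep_tuples S 3| =
  \sum_(A : {set S}) \sum_(B : {set S}) \sum_(C : {set S})
    indep_sizes3 #|A| #|B| #|C| #|A :&: B| #|A :&: C| #|B :&: C| #|A :&: B :&: C|.
Proof.
rewrite -[6]/(3`!) card_indep_familiesE sum_ffunS; apply: eq_bigr => A _.
rewrite sum_ffunS; apply: eq_bigr => B _; rewrite sum_ffunS; apply: eq_bigr => C _.
rewrite (sum_ffun0 _ [ffun=> set0]); congr nat_of_bool.
rewrite forallb_big !big_ord_recl big_ord0 /= !fconsS !fcons0 andbT.
rewrite /indep_sizes3 /indep_sizes2.
apply/idP/idP => [/andP[/and3P[-> -> ->] indA] | ].
  have /= := independent_seq S_gt0 [:: ord0; lift ord0 ord0] indA isT.
  have /= := independent_seq S_gt0 [:: ord0; lift ord0 (lift ord0 ord0)] indA isT.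
  have /= := independent_seq S_gt0 [:: lift ord0 ord0; lift ord0 (lift ord0 ord0)] indA isT.
  have /= := independent_seq S_gt0 [:: ord0; lift ord0 ord0; lift ord0 (lift ord0 ord0)] indA isT.
  by rewrite !big_cons !big_nil !fconsS !fcons0 !setIT setIA hS; lia.
move=> /and5P[/and3P[-> -> /eqP AB] -> /eqP AC /eqP BC /eqP ABC] /=.
rewrite independentE //; apply/forallP => I.
rewrite -[#|I|]sum1_card !(big_mkcond (fun i => i \in I)).
rewrite !big_ord_recl !big_ord0 /= !fconsS !fcons0 hS.
case: (_ \in I); case: (_ \in I); case: (_ \in I);
  rewrite /= ?setIT ?setTI ?setIA ?cardsT ?hS; lia.
Qed.

End Twelve.

(* The number of ordered independent pairs (triples), with [sum n F] standing for the
   sum of [F x] weighted by the number of [x]-subsets of an [n]-set; a size is chosen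
   for the part of each new event in each atom of the previous ones. The sum is a
   parameter so that it can be evaluated in binary. *)
Definition pair_count {T : Type} (sum : nat -> (nat -> T) -> T) (of_bool : bool -> T) : T :=
  sum 12 (fun a => sum a (fun x => sum (12 - a) (fun y =>
    of_bool (indep_sizes2 a (x + y) x)))).

Definition triple_count {T : Type} (sum : nat -> (nat -> T) -> T) (of_bool : bool -> T) : T :=
  sum 12 (fun a => sum a (fun x => sum (12 - a) (fun y =>
    sum x (fun x11 => sum (a - x) (fun x10 =>
    sum y (fun x01 => sum (12 - a - y) (fun x00 =>
      of_bool (indep_sizes3 a (x + y) (x11 + x10 + (x01 + x00))
                 x (x11 + x10) (x11 + x01) x11)))))))).

(** * Ordered counts as sums over atom sizes *)

Lemma sum_set_card {S : finType} (F : nat -> nat) : \sum_(A : {set S}) F #|A| = bsum #|S| F.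
Proof.
rewrite -cardsT -sum_subset_card; apply: eq_bigl => A; exact/esym/subsetT.
Qed.

Lemma card_setC_sub {S : finType} (A : {set S}) : #|S| - #|A| = #|~: A|.
Proof. by rewrite [RHS]cardsCs setCK. Qed.

Lemma sum_set_split2 {S : finType} (A : {set S}) (F : nat -> nat -> nat) :
  \sum_(B : {set S}) F #|B :&: A| #|B :\: A| = bsum #|A| (fun x => bsum (#|S| - #|A|) (F x)).
Proof.
have := sum_subset_split_card A [set: S] F; rewrite setTI setTD card_setC_sub => <-.
by apply: eq_bigl => B; exact/esym/subsetT.
Qed.

Lemma pair_countE {S : finType} : #|S| = 12 -> 2 * #|indep_tuples S 2| = pair_count bsum nat_of_bool.
Proof.
move=> hS; rewrite card_indep_pairs // /pair_count -hS -sum_set_card.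
apply: eq_bigr => A _; rewrite -(sum_set_split2 A (fun x y => indep_sizes2 #|A| (x + y) x)).
by apply: eq_bigr => B _; rewrite cardsID setIC.
Qed.

(** [B] is cut by [A] into parts of sizes [x] and [y]; the atoms that then cut [C] have sizes [x],
    [a - x], [y] and [12 - a - y]. *)
Lemma triple_countE {S : finType} : #|S| = 12 -> 6 * #|indep_tuples S 3| = triple_count bsum nat_of_bool.
Proof.
move=> hS; rewrite card_indep_triples // /triple_count.
rewrite -hS -sum_set_card; apply: eq_bigr => A _.
rewrite -(sum_set_split2 A (fun x y => bsum x (fun x11 => bsum (#|A| - x) (fun x10 =>
    bsum y (fun x01 => bsum (#|S| - #|A| - y) (fun x00 =>
      indep_sizes3 #|A| (x + y) (x11 + x10 + (x01 + x00)) x (x11 + x10) (x11 + x01) x11)))))).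
apply: eq_bigr => B _; rewrite cardsID.
have -> : #|S| - #|A| - #|B :\: A| = #|~: A :\: B|.
  by rewrite card_setC_sub -(cardsID B (~: A)) setIC -setDE addKn.
have -> : #|A| - #|B :&: A| = #|A :\: B| by rewrite cardsD setIC.
have -> : B :\: A = ~: A :&: B by rewrite setIC -setDE.
rewrite (setIC B A) -(sum_set_split4 A B (fun x11 x10 x01 x00 =>
  indep_sizes3 #|A| #|B| (x11 + x10 + (x01 + x00)) #|A :&: B| (x11 + x10) (x11 + x01) x11)).
apply: eq_bigr => C _.
rewrite !cardsID setIDAC (setIAC C) cardsID (setIC A C) (setIC B C).
by rewrite (setIC (A :&: B)) (setIC A B) setIA.
Qed.

(** * Binary evaluation of the counts *)

(** A [foldr] reduces under [vm_compute], whereas big operators are locked. *)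
Definition bsumN (n : nat) (F : nat -> N) : N :=
  foldr (fun x s => N.add (N.mul (N.of_nat 'C(n, x)) (F x)) s) 0%num (iota 0 n.+1).

Lemma N_of_nat_bsum n F : N.of_nat (bsum n F) = bsumN n (N.of_nat \o F).
Proof.
rewrite /bsum -(big_mkord xpredT (fun x => 'C(n, x) * F x)) /bsumN /index_iota subn0.
elim: (iota 0 n.+1) => [|x s IHs]; first by rewrite big_nil.
by rewrite big_cons [RHS]/= -IHs Nnat.Nat2N.inj_add Nnat.Nat2N.inj_mul.
Qed.

Lemma eq_bsumN n F G : F =1 G -> bsumN n F = bsumN n G.
Proof. by move=> FG; rewrite /bsumN; elim: (iota _ _) => //= x s ->; rewrite FG. Qed.


Lemma N_of_nat_pair_count :
  N.of_nat (pair_count bsum nat_of_bool) = pair_count bsumN (N.of_nat \o nat_of_bool).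
Proof. by do 3 (rewrite N_of_nat_bsum; apply: eq_bsumN => ? /=). Qed.

Lemma N_of_nat_triple_count :
  N.of_nat (triple_count bsum nat_of_bool) = triple_count bsumN (N.of_nat \o nat_of_bool).
(* One round for each of the seven nested sums. *)
Proof. by do 7 (rewrite N_of_nat_bsum; apply: eq_bsumN => ? /=). Qed.

(* The constant under which numerals above 5000 are parsed in [nat]. *)
Lemma N_of_nat_numeral d : N.of_nat (Nat.of_num_uint (Number.UIntDecimal d)) = N.of_uint d.
Proof.
rewrite /Nat.of_num_uint [RHS]Unsigned.of_uint_alt DecimalNat.Unsigned.of_uint_alt.
by elim: (Decimal.rev d) => // {}d; cbn -[Nat.mul N.mul Nat.add N.add]; lia.
Qed.

Lemma eq_numeral n d :
  N.of_nat n = N.of_uint d -> n = Nat.of_num_uint (Number.UIntDecimal d).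
Proof. by rewrite -N_of_nat_numeral => /Nnat.Nat2N.inj. Qed.

(* Keeping the numeral behind a variable here prevents unification from unfolding it in
   unary. *)
Lemma eq_muln_numeral n m d :
  N.of_nat n = N.mul (N.of_nat m) (N.of_uint d) ->
  n = m * Nat.of_num_uint (Number.UIntDecimal d).
Proof. by rewrite -N_of_nat_numeral -Nnat.Nat2N.inj_mul => /Nnat.Nat2N.inj. Qed.

Lemma N_of_nat_card_pairs {S : finType} :
  #|S| = 12 -> N.of_nat #|indep_tuples S 2| = 888888%num.
Proof.
move=> hS; have := congr1 N.of_nat (pair_countE hS).
rewrite N_of_nat_pair_count.
(* Ordered pairs: twice 888888. *)
have -> : pair_count bsumN (N.of_nat \o nat_of_bool) = 1777776%num by vm_compute.
by lia.
Qed.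

Lemma N_of_nat_card_triples {S : finType} :
  #|S| = 12 -> N.of_nat #|indep_tuples S 3| = 29937600%num.
Proof.
move=> hS; have := congr1 N.of_nat (triple_countE hS).
rewrite N_of_nat_triple_count.
(* Ordered triples: six times 29937600. *)
have -> : triple_count bsumN (N.of_nat \o nat_of_bool) = 179625600%num by vm_compute.
by lia.
Qed.

(** * No four independent events *)

(** What independence forces on the sizes alone, because intersections have integral cardinals. *)
Definition indep_sizes_divisible (a b c : nat) : bool :=
  [&& 12 %| a * b, 12 %| a * c, 12 %| b * c & 144 %| a * b * c].

Lemma indep_sizes_six (a b c : nat) :
  proper_size a -> proper_size b -> proper_size c -> indep_sizes_divisible a b c ->
  (a == 6) + (b == 6) + (c == 6) = 2.
Proof.
have mem_proper x : proper_size x = (x \in iota 1 11) by rewrite mem_iota.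
rewrite !mem_proper => a_in b_in c_in div_abc; apply/eqP.
(* Exhaustive check of the [11 ^ 3] triples of proper sizes. *)
have check : all (fun a => all (fun b => all (fun c => indep_sizes_divisible a b c ==>
    ((a == 6) + (b == 6) + (c == 6) == 2)) (iota 1 11)) (iota 1 11)) (iota 1 11).
  by vm_compute.
exact: (implyP (allP (allP (allP check a a_in) b b_in) c c_in)).
Qed.

(** The cardinals of the intersections are the quotients that witness the divisibilities. *)
Lemma indep_three_sizes {S : finType} {k : nat} {A : 'I_k -> {set S}} (i j l : 'I_k) :
  #|S| = 12 -> (forall i, proper_size #|A i|) -> independent A -> uniq [:: i; j; l] ->
  (#|A i| == 6) + (#|A j| == 6) + (#|A l| == 6) = 2.
Proof.
move=> hS szA indA ijl; have S_gt0 : 0 < #|S| by rewrite hS.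
have /and3P[]: [&& uniq [:: i; j], uniq [:: i; l] & uniq [:: j; l]].
  by move: ijl; rewrite /= !inE !negb_or !andbT => /andP[/andP[-> ->] ->].
move=> /(independent_seq S_gt0 _ indA) + /(independent_seq S_gt0 _ indA) +
  /(independent_seq S_gt0 _ indA) +.
have /= := independent_seq S_gt0 _ indA ijl.
rewrite !big_cons !big_nil hS /= => Eijl Eij Eil Ejl.
apply: indep_sizes_six => //; apply/and4P; split; apply/dvdnP.
- by exists #|A i :&: (A j :&: setT)|; lia.
- by exists #|A i :&: (A l :&: setT)|; lia.
- by exists #|A j :&: (A l :&: setT)|; lia.
- by exists #|A i :&: (A j :&: (A l :&: setT))|; lia.
Qed.

(** Among four of the events, each triple has exactly two of size 6. Summing over the four triples
    counts each event three times, so three times the number of events of size 6 would be 8. *)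
Lemma indep_tuples_ge4 {S : finType} (k : nat) :
  #|S| = 12 -> 4 <= k -> indep_tuples S k = set0.
Proof.
move=> hS k4; apply/setP => F; rewrite inE; apply/negP => /imsetP[A].
rewrite inE hS => /and3P[_ /forallP szA indA] _.
pose i0 : 'I_k := Ordinal (leq_trans (isT : 0 < 4) k4).
pose i1 : 'I_k := Ordinal (leq_trans (isT : 1 < 4) k4).
pose i2 : 'I_k := Ordinal (leq_trans (isT : 2 < 4) k4).
pose i3 : 'I_k := Ordinal (leq_trans (isT : 3 < 4) k4).
have := indep_three_sizes i0 i1 i2 hS szA indA isT.
have := indep_three_sizes i0 i1 i3 hS szA indA isT.
have := indep_three_sizes i0 i2 i3 hS szA indA isT.
have := indep_three_sizes i1 i2 i3 hS szA indA isT.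
by lia.
Qed.

(** * Total over all tuple lengths *)

Lemma all_indep_tuplesE {S : finType} :
  #|S| = 12 -> all_indep_tuples S = indep_tuples S 2 :|: indep_tuples S 3.
Proof.
move=> hS; have S_gt0 : 0 < #|S| by rewrite hS.
apply/setP => F; rewrite !inE.
have cardF k : F \in indep_tuples S k -> #|F| = k.
  by rewrite mem_indep_tuples // => /and3P[/eqP].
apply/andP/orP => [[F2 indF] | [] indF]; last 2 first.
- by rewrite (cardF _ indF).
- by rewrite (cardF _ indF).
case: (leqP 4 #|F|) => [F4 | ]; first by rewrite indep_tuples_ge4 // inE in indF.
rewrite ltnS leq_eqVlt ltnS => /orP[/eqP <- | F2']; [by right | left].
by have <- : #|F| = 2 by apply/eqP; rewrite eqn_leq F2'.
Qed.

Theorem mainTheorem2 (S : finType) (hS : #|S| = 12) :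
  [/\ #|all_indep_tuples S| = #|indep_tuples S 2| + #|indep_tuples S 3|,
      #|indep_tuples S 2| = 888888,
      #|indep_tuples S 3| = 2 * 14968800,
      (forall k : nat, 4 <= k -> #|indep_tuples S k| = 0)
    & #|all_indep_tuples S| = 30826488].
Proof.
have S_gt0 : 0 < #|S| by rewrite hS.
have sumE : #|all_indep_tuples S| = #|indep_tuples S 2| + #|indep_tuples S 3|.
  rewrite all_indep_tuplesE // cardsU.
  (* The two sets are disjoint, as [#|F|] cannot be both 2 and 3. *)
  suff -> : indep_tuples S 2 :&: indep_tuples S 3 = set0 by rewrite cards0 subn0.
  apply/setP => F; rewrite !inE !mem_indep_tuples //.
  by apply/negP => /andP[/and3P[/eqP-> _ _] /and3P[]].
have card2 := N_of_nat_card_pairs hS; have card3 := N_of_nat_card_triples hS.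
split.
- exact: sumE.
- by apply: eq_numeral; rewrite card2.
- by apply: eq_muln_numeral; rewrite card3.
- by move=> k k4; rewrite indep_tuples_ge4 // cards0.
- by rewrite sumE; apply: eq_numeral; rewrite [LHS]Nnat.Nat2N.inj_add card2 card3.
Qed.
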